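(* Let $0<p<1$ and $0<r<1$. For a network with generate-at-will packet arrivals over the Gilbert-Elliott erasure channel $GE(p,r)$, where under the preemptive last-generated-first-served (pLGFS) policy the transmitter generates a new packet in every time slot, the average age of information is $$\Delta_{wiL}=1+\frac{p}{r(p+r)}.$$
   Context: Time is slotted, $t=1,2,\dots$. Packets are generated at the beginning of a slot. At most one packet is transmitted per slot; a packet transmitted in slot $t$ and not erased is received at the end of slot $t$, i.e. is available at the receiver at the beginning of slot $t+1$. A packet may be transmitted in the same slot in which it is generated. Channel $GE(p,r)$: the channel state is a two-state Markov chain on $\{G,B\}$ (one step per slot) with transition probability $p$ from $G$ to $B$ and $r$ from $B$ to $G$. A transmission in a slot with state $G$ always succeeds (erasure probability $0$), and in a slot with state $B$ always fails (erasure probability $1$). Generate-at-will arrival: the transmitter can generate a packet whenever it wants. Under pLGFS in this model it generates a packet at the beginning of every slot, and this new packet preempts (replaces) any undelivered older packet, so that in every slot the packet just generated is the one transmitted. Age of information (AoI): at the beginning of slot $t$, $\Delta_t=t-u_t$, where $u_t$ is the generation slot of the latest (most recently generated) packet received by the beginning of slot $t$. The average AoI is the long-run time average $\lim_{\tau\to\infty}\frac1\tau\sum_{t=1}^{\tau}\Delta_t$ (almost surely; the value assigned before the first delivery is irrelevant). *)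

(* Defs.v *)
From HB Require Import structures.
From mathcomp Require Import all_boot all_order all_algebra.
From mathcomp Require Import all_classical all_reals all_analysis.

Set Implicit Arguments.
Unset Strict Implicit.
Unset Printing Implicit Defensive.

Import Order.TTheory GRing.Theory Num.Theory.
Import numFieldNormedType.Exports.

Local Open Scope classical_set_scope.
Local Open Scope ring_scope.

(* Slots are the natural numbers t >= 1; index 0 is not a slot, and nothing
   below constrains or reads the channel state at index 0.  A packet is
   identified with the slot in which it is generated.  Channel states are
   booleans: true is the state G (the transmission succeeds), false is the
   state B (the transmission is erased). *)

Section GilbertElliott.
Context {d : measure_display} {T : measurableType d} {R : realType}.
Variable P : probability T R.

(* Only meaningful when P B is nonzero. *)
Definition cond_prob (A B : set T) : R := fine (P (A `&` B)) / fine (P B).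

Definition ge_trans (p r : R) (i j : bool) : R :=
  match i, j with
  | true, true => 1 - p
  | true, false => p
  | false, true => r
  | false, false => 1 - r
  end.

Definition history (X : nat -> {RV P >-> bool}) (t : nat) (s : nat -> bool) :
  set T := [set w | forall i, (1 <= i <= t)%N -> X i w = s i].

(* The state process of GE(p,r): a time-homogeneous Markov chain, with no
   restriction on the distribution of the state in slot 1. *)
Definition ge_channel (p r : R) (X : nat -> {RV P >-> bool}) : Prop :=
  forall (t : nat) (s : nat -> bool) (j : bool), (1 <= t)%N ->
    P (history X t s) != 0%E ->
    cond_prob [set w | X t.+1 w = j] (history X t s) = ge_trans p r (s t) j.

End GilbertElliott.

(* The system along one sample path: [gen t] says that a packet is generated
   at the beginning of slot t, [ok t] that the channel is in state G in
   slot t. *)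

(* Packet transmitted in slot t under pLGFS.  The queue holds at most one
   packet: a new packet preempts the one present; otherwise the packet sent in
   the previous slot, if any, is sent again unless it was received. *)
Fixpoint plgfs_sent (gen ok : nat -> bool) (t : nat) : option nat :=
  match t with
  | 0 => None
  | t'.+1 => if gen t then Some t
             else if ok t' then None else plgfs_sent gen ok t'
  end.

(* Packets received by the beginning of slot t, given the packet [sent s]
   transmitted in each slot s. *)
Definition received (sent : nat -> option nat) (ok : nat -> bool) (t : nat) :
  seq nat := pmap sent [seq s <- iota 1 t.-1 | ok s].

(* The age at the beginning of slot t; [init t] is the value assigned as long
   as no packet has been received. *)
Definition aoi (R : realType) (init : nat -> R) (sent : nat -> option nat)
    (ok : nat -> bool) (t : nat) : R :=
  if received sent ok t is [::] then init t
  else t%:R - (\max_(u <- received sent ok t) u)%:R.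

Definition generate_at_will : nat -> bool := fun=> true.

Definition plgfs_aoi (R : realType) (init : nat -> R) (gen ok : nat -> bool)
    (t : nat) : R := aoi init (plgfs_sent gen ok) ok t.

(* [l] is the almost sure long-run time average of the process D. *)
Definition time_average_as (d : measure_display) (T : measurableType d)
    (R : realType) (P : probability T R) (D : nat -> T -> R) (l : R) : Prop :=
  {ae P, forall w, (fun tau : nat =>
     (tau%:R)^-1 * \sum_(1 <= t < tau.+1) D t w) @ \oo --> l}.

(* Main.v *)
Require Import Defs.
From HB Require Import structures.
From mathcomp Require Import all_boot all_order all_algebra.
From mathcomp Require Import all_classical all_reals all_analysis.
From mathcomp Require Import measurable_realfun.
From mathcomp Require Import zify ring lra.
Import Order.TTheory GRing.Theory Num.Theory.
Import numFieldNormedType.Exports.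
Local Open Scope classical_set_scope.
Local Open Scope ring_scope.

(** Let A n be the number of consecutive B slots ending at slot n.  Once a
    packet has been received, the age at the beginning of slot n+1 is
    1 + A n.  With c := p / (r (p + r)), the function
    f a := a / r + (1 / (r (p + r)) - 1 / r) [a > 0] solves the Poisson equation
    f (A n) - E[f (A n.+1) | X 1, ..., X n] = A n - c, so that
    \sum_(i < n) (A i - c) + f (A n) is a martingale.  The second moment of
    A n is bounded (drift towards 0), hence the centered sum has second moment
    O(n).  Along the squares n = k^2 the second moments of the averages are
    summable, which gives almost sure convergence; between consecutive squares
    one uses that the partial sums of A are nondecreasing. *)

(** * Run lengths and the age along one sample path *)

(* Newest slot first. *)
Fixpoint past (x : nat -> bool) (n : nat) : seq bool :=
  if n is m.+1 then x n :: past x m else [::].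

Fixpoint bad_run (s : seq bool) : nat :=
  if s is j :: s' then (if j then 0 else (bad_run s').+1)%N else 0%N.

(* The newest state does not contribute: this is the sum of [A i - c] over
   [i < size s]. *)
Fixpoint excess {R : realType} (c : R) (s : seq bool) : R :=
  if s is _ :: s' then excess c s' + (bad_run s')%:R - c else 0.

Lemma size_past x n : size (past x n) = n.
Proof. by elim: n => //= n ->. Qed.

Lemma nth_past x n i : (0 < i <= n)%N -> nth true (past x n) (n - i) = x i.
Proof.
elim: n => [|n IHn] /andP[i0 ile]; first by lia.
have [<-|ni] := eqVneq n.+1 i; first by rewrite subnn.
by rewrite subSn /=; [apply: IHn; lia | lia].
Qed.

Lemma bad_run_size s : (bad_run s <= size s)%N.
Proof. by elim: s => //= j s IHs; case: j. Qed.

Lemma iota1S n : iota 1 n.+1 = iota 1 n ++ [:: n.+1].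
Proof. by rewrite -[in LHS](addn1 n) iotaD add1n. Qed.

(** The slots up to the last G slot and the B run after it make up the slots from 1 to n. Without a
    G slot the empty maximum is 0 and the run has length n. *)
Lemma max_good_slot (x : nat -> bool) n :
  (\max_(u <- [seq s <- iota 1 n | x s]) u + bad_run (past x n) = n)%N.
Proof.
elim: n => [|n IHn]; first by rewrite big_nil.
rewrite iota1S filter_cat big_cat /=.
case: ifP => xn; last by rewrite big_nil maxn0 addnS IHn.
rewrite big_seq1 addn0; apply/maxn_idPr; lia.
Qed.

(** The packet sent in slot s is s itself, so the received packets are exactly the G slots. The
    witness [g] keeps this list nonempty and thus rules out [init]. *)
Lemma plgfs_aoi_past (R : realType) (init : nat -> R) (x : nat -> bool) g n :
  (0 < g <= n)%N -> x g ->
  plgfs_aoi init generate_at_will x n.+1 = 1 + (bad_run (past x n))%:R.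
Proof.
move=> /andP[g0 gn] xg.
have recE : received (plgfs_sent generate_at_will x) x n.+1
    = [seq s <- iota 1 n | x s].
  rewrite /received /=; elim: n {gn} => [//|n IHn].
  rewrite iota1S !filter_cat pmap_cat IHn /=.
  by case: ifP.
rewrite /plgfs_aoi /aoi recE.
have : g \in [seq s <- iota 1 n | x s] by rewrite mem_filter xg mem_iota; lia.
have := max_good_slot x n.
case: [seq s <- iota 1 n | x s] => [//|u l] e _.
by rewrite -[X in X.+1%:R]e -addSn natrD -addn1 natrD; ring.
Qed.

Lemma excess_past (R : realType) (c : R) x n :
  excess c (past x n) = (\sum_(0 <= i < n) bad_run (past x i))%:R - n%:R * c.
Proof.
elim: n => [|n IHn] /=; first by rewrite big_geq // mul0r subr0.
by rewrite IHn big_nat_recr //= natrD -addn1 natrD; ring.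
Qed.

(** * From convergence along squares to convergence of averages *)

Lemma sqrt_interval n : exists k, (k ^ 2 <= n < k.+1 ^ 2)%N.
Proof.
elim: n => [|n [k /andP[k1 k2]]]; first by exists 0%N.
have [h|h] := ltnP n.+1 (k.+1 ^ 2); first by exists k; rewrite h (leqW k1).
by exists k.+1; rewrite h /=; nia.
Qed.

(** Monotonicity sandwiches [a n] between its values at the neighbouring squares, whose distance 2k
    + 1 is negligible compared with k^2. *)
Lemma cvg_squares (R : realType) (a : nat -> R) (c : R) : 0 <= c ->
  (forall m n, (m <= n)%N -> a m <= a n) ->
  (fun k : nat => (a (k ^ 2)%N - (k ^ 2)%:R * c) / (k ^ 2)%:R) @ \oo --> (0 : R) ->
  (fun n : nat => (a n - n%:R * c) / n%:R) @ \oo --> (0 : R).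
Proof.
move=> c0 a_mono /cvgrPdist_le cu; apply/cvgrPdist_le => e e0.
(* Error budget in units of e k^2 / 8: at most 4 from (k+1)^2 <= 4 k^2, and 3 from c (2k+1) <= 3 c
   k, once 8 c <= e k. *)
have e8 : 0 < e / 8 by lra.
have [K _ HK] := cu _ e8.
pose N := maxn (maxn K 1) (Num.truncn (8 * c / e)).+1.
exists (N ^ 2)%N => // n /= Nn.
have [k /andP[k1 k2]] := sqrt_interval n.
have Nk : (N <= k)%N by rewrite -ltnS -ltn_sqr (leq_ltn_trans Nn).
have k0 : (0 < k)%N by apply: leq_trans Nk; rewrite !leq_max orbT.
have Kk : (K <= k)%N by apply: leq_trans Nk; rewrite !leq_max leqnn.
have kc : 8 * c <= e * k%:R.
  rewrite [e * _]mulrC -ler_pdivrMr //.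
  apply: (le_trans (ltW (truncnS_gt _))).
  by rewrite ler_nat (leq_trans _ Nk) // /N leq_maxr.
have H1 := HK k Kk; have H2 := HK k.+1 (leqW Kk).
rewrite /= !sub0r !normrN in H1 H2 *.
have kR : 1 <= k%:R :> R by rewrite ler1n.
have sq m : (m ^ 2)%:R = m%:R ^+ 2 :> R by rewrite natrX.
have nR : k%:R ^+ 2 <= n%:R :> R by rewrite -sq ler_nat.
have nR' : n%:R <= (k%:R + 1) ^+ 2 :> R.
  by rewrite natr1 -sq ler_nat ltnW.
have n0 : 0 < n%:R :> R by nra.
have a1 := a_mono _ _ k1; have a2 := a_mono _ _ (ltnW k2).
rewrite !normrM !normfV !sq in H1 H2; rewrite -[k.+1%:R]natr1 in H2.
rewrite normrM normfV.
rewrite !(@ger0_norm _ (_ ^+ 2)) ?sqr_ge0 // in H1 H2.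
rewrite (gtr0_norm n0) ler_pdivrMr //.
rewrite ler_pdivrMr in H1; last by nra.
rewrite ler_pdivrMr in H2; last by nra.
move: H1 H2; rewrite !ler_norml => /andP[H1 _] /andP[_ H2].
have ck : c * k%:R * 8 <= e * k%:R ^+ 2 by nra.
have cn : c * (n%:R - k%:R ^+ 2) <= c * (3 * k%:R).
  by apply: ler_wpM2l => //; nra.
have cn' : c * ((k%:R + 1) ^+ 2 - n%:R) <= c * (3 * k%:R).
  by apply: ler_wpM2l => //; nra.
have en : e * k%:R ^+ 2 <= e * n%:R by apply: ler_wpM2l => //; exact: ltW.
have ek : e * (k%:R + 1) ^+ 2 <= e * (4 * k%:R ^+ 2).
  by apply: ler_wpM2l; [exact: ltW | nra].
have en0 : 0 < e * n%:R by exact: mulr_gt0.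
by apply/andP; split; lra.
Qed.

(** After the first delivery the age sum and the excess have the same increments up to the drift 1 +
    c, so they differ by a linear term and a constant. *)
Lemma time_average_past (R : realType) (c : R) (init : nat -> R)
    (x : nat -> bool) :
  (fun n : nat => excess c (past x n) / n%:R) @ \oo --> (0 : R) ->
  (fun tau : nat => tau%:R^-1 *
     \sum_(1 <= t < tau.+1) plgfs_aoi init generate_at_will x t)
    @ \oo --> 1 + c.
Proof.
move=> cx.
(* Without a G slot the excess would grow quadratically. *)
have [g /andP[g0 xg]] : exists g, (0 < g)%N && x g.
  apply/not_existsP => no_good.
  have run n : bad_run (past x n) = n.
    elim: n => //= n ->; case: ifP => // xn.
    by have := no_good n.+1; rewrite xn.
  have sum_id n : (\sum_(0 <= i < n.+1) bad_run (past x i))%:R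
      = n.+1%:R * n%:R / 2 :> R.
    elim: n => [|n IHn]; first by rewrite big_nat1 run mulr0 mul0r.
    by rewrite big_nat_recr // [bad_run _]run natrD IHn -!natr1; field.
  move/cvgrPdist_le : cx => /(_ 1 ltr01)[K _ HK].
  pose n := (K + (Num.truncn (2 * (1 + c))).+1)%N.
  have Kn : (K <= n.+1)%N by lia.
  have : `|0 - excess c (past x n.+1) / n.+1%:R| <= 1 := HK n.+1 Kn.
  rewrite excess_past sum_id sub0r normrN -mulrA -mulrBr mulrAC.
  rewrite mulfV ?pnatr_eq0 // mul1r ler_norml => /andP[_ h].
  have : 2 * (1 + c) < n%:R.
    by apply: (lt_le_trans (truncnS_gt _)); rewrite ler_nat leq_addl.
  lra.
pose age := plgfs_aoi init generate_at_will x.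
(* [K] absorbs all slots up to [g], including the [init] values; it vanishes after division by n. *)
pose K := \sum_(1 <= t < g.+1) age t - g%:R * (1 + c) - excess c (past x g).
have ageE m : \sum_(1 <= t < (g + m).+1) age t
    = (g + m)%:R * (1 + c) + excess c (past x (g + m)) + K.
  elim: m => [|m IHm]; first by rewrite addn0 /K; ring.
  rewrite addnS big_nat_recr //= IHm /age (@plgfs_aoi_past _ _ _ g) //; last first.
    by rewrite g0 leq_addr.
  by rewrite -natr1; ring.
have c1 : (fun n : nat => 1 + c + excess c (past x n) / n%:R + K * n%:R^-1)
    @ \oo --> 1 + c + 0 + K * 0.
  apply: cvgD; first by apply: cvgD => //; exact: cvg_cst.
  apply: cvgM; first exact: cvg_cst.
  by rewrite -(cvg_shiftS (fun n : nat => n%:R^-1 : R)); exact: cvg_harmonic.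
rewrite addr0 mulr0 addr0 in c1.
apply: cvg_trans c1; apply: near_eq_cvg; exists g => // n /= gn.
have n0 : n%:R != 0 :> R by rewrite pnatr_eq0; lia.
by rewrite -/age -(subnKC gn) ageE (subnKC gn); field.
Qed.

(** * Expectations of functions of the channel history *)

Fixpoint states (n : nat) : seq (seq bool) :=
  if n is m.+1 then [seq j :: s | s <- states m, j <- [:: true; false]]
  else [:: [::]].

Lemma big_states (R : realType) n (F : seq bool -> R) :
  \sum_(s <- states n.+1) F s
  = \sum_(s <- states n) (F (true :: s) + F (false :: s)).
Proof.
rewrite [states n.+1]/[seq j :: s | s <- states n, j <- [:: true; false]].
rewrite big_allpairs_dep; apply: eq_bigr => s _.
by rewrite big_cons big_seq1.
Qed.

Lemma size_states {n s} : s \in states n -> size s = n.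
Proof.
elim: n s => [|n IHn] s; first by rewrite inE => /eqP ->.
by case/allpairsP => -[u j] [/IHn <- _ ->].
Qed.

(** Writes a function of the history as a finite combination of indicators, which yields both
    measurability and the integral. *)
Lemma states_expand (R : realType) (x : nat -> bool) n (g : seq bool -> R) :
  g (past x n) = \sum_(s <- states n) g s * (past x n == s)%:R.
Proof.
elim: n g => [|n IHn] g; first by rewrite big_seq1 eqxx mulr1.
rewrite big_states /= (IHn (fun s => g (x n.+1 :: s))).
apply: eq_bigr => s _; rewrite !eqseq_cons.
by case: (x n.+1); rewrite /= ?mulr0 ?addr0 ?add0r.
Qed.

Section ChannelLaw.
Context {d : measure_display} {T : measurableType d} {R : realType}.
Context {P : probability T R} (X : nat -> {RV P >-> bool}).

Definition hist n (w : T) : seq bool := past (fun i => X i w) n.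

(** The expectation of [g (hist n w)] as a finite sum, so that linearity and monotonicity for signed
    [g] carry no integrability conditions. *)
Definition mean n (g : seq bool -> R) : R :=
  \sum_(s <- states n) g s * fine (P [set w | hist n w = s]).

Lemma measurable_state i (b : bool) : measurable [set w | X i w = b].
Proof.
rewrite -[X in measurable X]setTI.
exact: (measurable_funPT (X i) measurableT [set b]).
Qed.

Lemma measurable_hist n s : measurable [set w | hist n w = s].
Proof.
elim: n s => [|n IHn] [|j s].
- by rewrite (_ : [set _ | _] = setT) //; apply/seteqP.
- by rewrite (_ : [set _ | _] = set0) //; apply/seteqP; split => // w /=.
- by rewrite (_ : [set _ | _] = set0) //; apply/seteqP; split => // w /=.
rewrite (_ : [set _ | _] = [set w | X n.+1 w = j] `&` [set w | hist n w = s]).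
  by apply: measurableI => //; exact: measurable_state.
by apply/seteqP; split => w /= [<- <-].
Qed.

Lemma hist_indic n s w :
  (hist n w == s)%:R = \1_[set w | hist n w = s] w :> R.
Proof.
by rewrite indicE; congr ((nat_of_bool _)%:R); apply/eqP/idP; rewrite inE.
Qed.

Lemma measurable_hist_fun n (g : seq bool -> R) :
  measurable_fun setT (fun w => g (hist n w)).
Proof.
under eq_fun do rewrite /hist states_expand.
apply: measurable_sum => s; apply: measurable_funM; first exact: measurable_cst.
under eq_fun do rewrite hist_indic.
by apply: measurable_indic; exact: measurable_hist.
Qed.

Lemma integral_hist n (g : seq bool -> R) : (forall s, 0 <= g s) ->
  (\int[P]_w (g (hist n w))%:E = (mean n g)%:E)%E.
Proof.
move=> g0.
under eq_integral do rewrite /hist states_expand -sumEFin.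
rewrite ge0_integral_sum //.
- rewrite /mean -sumEFin; apply: eq_bigr => s _.
  under eq_integral do rewrite hist_indic EFinM.
  rewrite ge0_integralZl //.
  + rewrite integral_indic ?setIT //; last exact: measurable_hist.
    by rewrite EFinM fineK // fin_num_measure //; exact: measurable_hist.
  + apply/measurable_EFinP; apply: measurable_indic; exact: measurable_hist.
  + by rewrite lee_fin g0.
- move=> s; apply/measurable_EFinP.
  apply: measurable_funM; first exact: measurable_cst.
  under eq_fun do rewrite hist_indic.
  by apply: measurable_indic; exact: measurable_hist.
- by move=> s w _; rewrite lee_fin mulr_ge0.
Qed.

Lemma mean_le n (g h : seq bool -> R) : (forall s, size s = n -> g s <= h s) ->
  mean n g <= mean n h.
Proof.
move=> gh; rewrite /mean big_seq [leRHS]big_seq; apply: ler_sum => s sn.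
by rewrite ler_wpM2r ?fine_ge0 // gh // (size_states sn).
Qed.

Lemma meanD n (g h : seq bool -> R) :
  mean n (fun s => g s + h s) = mean n g + mean n h.
Proof. by rewrite /mean -big_split /=; apply: eq_bigr => s _; rewrite mulrDl. Qed.

Lemma meanZ n (k : R) (g : seq bool -> R) :
  mean n (fun s => k * g s) = k * mean n g.
Proof. by rewrite /mean mulr_sumr; apply: eq_bigr => s _; rewrite mulrA. Qed.

Lemma mean_cst n (k : R) : mean n (fun=> k) = k.
Proof.
suff m1 : mean n (fun=> 1) = 1 by rewrite -{1}[k]mulr1 meanZ m1 mulr1.
apply: EFin_inj; rewrite -integral_hist //.
by rewrite integral_cst // mul1e; exact: probability_setT.
Qed.

(** Tower property: condition on the first n states. Since n > 0, [head true s] is the newest state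
    and never the default. *)
Lemma mean_step p r n (g : seq bool -> R) : ge_channel p r X -> (0 < n)%N ->
  mean n.+1 g = mean n (fun s =>
    Defs.ge_trans p r (head true s) true * g (true :: s)
    + Defs.ge_trans p r (head true s) false * g (false :: s)).
Proof.
move=> chX n0; rewrite /mean big_states big_seq [RHS]big_seq.
apply: eq_bigr => s /size_states sn.
have histE : [set w | hist n w = s]
    = history X n (fun i => nth true s (n - i)).
  apply/seteqP; split => w /= => [<- i i_n|h]; first by rewrite nth_past.
  apply: (@eq_from_nth _ true); first by rewrite size_past sn.
  rewrite size_past => i i_n.
  rewrite -[in LHS](subKn (ltnW i_n)) nth_past; last by lia.
  by rewrite h; [rewrite subKn // ltnW | lia].
suff Pstep j : fine (P [set w | hist n.+1 w = j :: s])
    = Defs.ge_trans p r (head true s) j * fine (P [set w | hist n w = s]).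
  by rewrite !Pstep; ring.
have -> : [set w | hist n.+1 w = j :: s]
    = [set w | X n.+1 w = j] `&` [set w | hist n w = s].
  by apply/seteqP; split => w /= [<- <-].
(* The channel hypothesis says nothing about null histories; there both sides are 0 by monotonicity
   of [P]. *)
have [P0|P0] := eqVneq (P [set w | hist n w = s]) 0%E.
  rewrite P0 mulr0 (_ : P _ = 0%E) //; apply/eqP; rewrite eq_le measure_ge0 andbT.
  rewrite -P0 le_measure ?inE //.
  - by apply: measurableI; [exact: measurable_state|exact: measurable_hist].
  - exact: measurable_hist.
have := chX n (fun i => nth true s (n - i)) j n0; rewrite -histE => /(_ P0).
rewrite subnn nth0 => <-; rewrite /cond_prob divfK //.
by rewrite fine_eq0 // fin_num_measure //; exact: measurable_hist.
Qed.

End ChannelLaw.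

(** * The Poisson equation and second moment bounds *)

Section SecondMoment.
Context {d : measure_display} {T : measurableType d} {R : realType}.
Variables (P : probability T R) (X : nat -> {RV P >-> bool}) (p r : R).
Hypotheses (p01 : 0 < p < 1) (r01 : 0 < r < 1) (chX : ge_channel p r X).

Let c : R := p / (r * (p + r)).
Let beta : R := (r * (p + r))^-1 - r^-1.

Definition potential (a : nat) : R := a%:R / r + beta * (0 < a)%N%:R.

Lemma potential0 : potential 0 = 0.
Proof. by rewrite /potential mul0r mulr0 addr0. Qed.

Lemma potentialS a : potential a.+1 = (a%:R + 1) / r + beta.
Proof. by rewrite /potential mulr1 natr1. Qed.

(** A G slot resets the run and [potential 0 = 0], so only the B term of the conditional expectation
    remains. The slope 1/r handles the terms linear in the run length, and [beta] is fixed by the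
    case of run length 0. *)
Lemma poisson_equation s : (0 < size s)%N ->
  Defs.ge_trans p r (head true s) false * potential (bad_run s).+1
  = potential (bad_run s) - (bad_run s)%:R + c.
Proof.
have /andP[p0 p1] := p01; have /andP[r0 r1] := r01.
have pr0 : p + r != 0 by lra.
have rn0 : r != 0 by lra.
case: s => [//|[] s] _; rewrite /= ?potential0 !potentialS /beta /c.
  by field; rewrite rn0 pr0.
by rewrite -natr1; field; rewrite rn0 pr0.
Qed.

Lemma ge_trans_true s :
  Defs.ge_trans p r (head true s) true = 1 - Defs.ge_trans p r (head true s) false.
Proof. by case: (head true s) => /=; ring. Qed.

Lemma ge_trans_false01 s : 0 <= Defs.ge_trans p r (head true s) false <= 1.
Proof.
have /andP[p0 p1] := p01; have /andP[r0 r1] := r01.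
by case: (head true s) => /=; apply/andP; split; lra.
Qed.

(* The drift of the squared run length is at most [- r / 2] times itself plus
   [D]. *)
Let D : R := 1 + 2 / r.

(** The second moments satisfy m' <= (1 - r/2) m + D, and 2 D / r is the fixed point of this
    recursion. *)
Lemma mean_bad_run_sq n : (0 < n)%N ->
  mean X n (fun s => (bad_run s)%:R ^+ 2) <= 2 * D / r.
Proof.
have /andP[p0 p1] := p01; have /andP[r0 r1] := r01.
have rV : 1 <= r^-1 by rewrite invf_ge1 // ltW.
have rVr : r * r^-1 = 1 by rewrite mulfV //; lra.
have D1 : 1 <= D by rewrite /D; lra.
elim: n => [//|[|n] IHn] _.
  apply: (@le_trans _ _ (mean X 1 (fun=> 1))); last by rewrite mean_cst; nra.
  apply: mean_le => s s1; rewrite exprn_ile1 ?ler0n // lern1 -s1.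
  exact: bad_run_size.
rewrite (mean_step X p r) //.
apply: (@le_trans _ _
    (mean X n.+1 (fun s => (1 - r / 2) * (bad_run s)%:R ^+ 2 + D))).
  apply: mean_le => s; case: s => [//|[] s] _ /=.
    by rewrite expr0n mulr0 mulr0 expr1n; lra.
  rewrite expr0n mulr0 add0r -natr1; set a := (bad_run s).+1%:R.
  rewrite /D -subr_ge0.
  (* Completing the square; the term 2 / r of [D] pays for the cross term - 2 a. *)
  have -> : (1 - r / 2) * a ^+ 2 + (1 + 2 / r) - (1 - r) * (a + 1) ^+ 2
    = r / 2 * (a - 2 / r) ^+ 2 + 2 * r * a + r by field; lra.
  have a0 : 0 <= a by rewrite ler0n.
  have := sqr_ge0 (a - 2 / r); nra.
rewrite meanD meanZ mean_cst; have := IHn isT; set m := mean _ _ _ => mB.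
have : (1 - r / 2) * m <= (1 - r / 2) * (2 * D / r) by apply: ler_wpM2l => //; lra.
have -> : (1 - r / 2) * (2 * D / r) = 2 * D / r - D by field; lra.
lra.
Qed.

Lemma potential_sq a :
  potential a ^+ 2 <= 2 / r ^+ 2 * a%:R ^+ 2 + 2 * beta ^+ 2.
Proof.
have -> : 2 / r ^+ 2 * a%:R ^+ 2 = 2 * (a%:R / r) ^+ 2 by rewrite expr_div_n; ring.
rewrite /potential; set x := _ / _.
case: (0 < a)%N; rewrite ?mulr1 ?mulr0; have := sqr_ge0 (x - beta); nra.
Qed.

Let M s : R := excess c s + potential (bad_run s).

(** Given the past, the next [M] is E + phi with probability q and E otherwise, with mean E + q phi,
    the current [M]. The second moment thus grows by the conditional variance q (1 - q) phi^2 <=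
    phi^2. *)
Lemma mean_martingale_sq n : (0 < n)%N ->
  mean X n.+1 (fun s => M s ^+ 2)
  <= mean X n (fun s => M s ^+ 2)
     + mean X n (fun s => potential (bad_run s).+1 ^+ 2).
Proof.
move=> n0; rewrite (mean_step X p r) // -meanD; apply: mean_le => s sn.
have := @poisson_equation s; rewrite sn => /(_ n0).
rewrite ge_trans_true; have /andP[] := ge_trans_false01 s.
set q := Defs.ge_trans _ _ _ _; rewrite /M /=; set phi := potential _.+1.
rewrite potential0; set e := excess c s; set a := (bad_run s)%:R => q0 q1 pq.
have -> : e + potential (bad_run s) = (e + a - c) + q * phi by rewrite pq; ring.
rewrite -subr_ge0.
set E := e + a - c.
have -> : (E + q * phi) ^+ 2 + phi ^+ 2
    - ((1 - q) * (E + 0) ^+ 2 + q * (E + phi) ^+ 2)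
  = (1 - q + q ^+ 2) * phi ^+ 2 by ring.
by rewrite mulr_ge0 ?sqr_ge0 //; nra.
Qed.

(** The excess is [M] minus the potential: the former has linearly growing second moment, the latter
    a bounded one. *)
Lemma mean_excess_sq : exists C, forall n, (0 < n)%N ->
  mean X n (fun s => excess c s ^+ 2) <= C * n%:R.
Proof.
have /andP[p0 p1] := p01; have /andP[r0 r1] := r01.
set B := 2 * D / r.
set W := 2 / r ^+ 2.
have rV : 0 < r^-1 by rewrite invr_gt0.
have B0 : 0 <= B by rewrite /B /D; nra.
have W0 : 0 <= W by rewrite divr_ge0 // sqr_ge0.
(* [V] bounds the martingale increment, using (a+1)^2 <= 2 a^2 + 2. *)
pose V := W * (2 * B + 2) + 2 * beta ^+ 2.
pose K := mean X 1 (fun s => M s ^+ 2).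
have MV n : (0 < n)%N -> mean X n (fun s => M s ^+ 2) <= K + V * n%:R.
  have V0 : 0 <= V.
    by rewrite /V addr_ge0 // mulr_ge0 ?sqr_ge0 //; lra.
  elim: n => [//|[|n] IHn] _; first by rewrite mulr1 lerDl.
  apply: (le_trans (mean_martingale_sq n.+1 isT)).
  rewrite -[n.+2%:R]natr1 mulrDr mulr1 addrA lerD ?IHn //.
  apply: (@le_trans _ _ (mean X n.+1 (fun s => 2 * W * (bad_run s)%:R ^+ 2
      + (2 * W + 2 * beta ^+ 2)))).
    apply: mean_le => s _; apply: (le_trans (potential_sq _)).
    rewrite -natr1 -/W; set a := (bad_run s)%:R.
    rewrite addrA lerD2r.
    have -> : 2 * W * a ^+ 2 + 2 * W = W * (2 * a ^+ 2 + 2) by ring.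
    by apply: ler_wpM2l => //; have := sqr_ge0 (a - 1); nra.
  rewrite meanD meanZ mean_cst.
  have := mean_bad_run_sq n.+1 isT; set m := mean _ _ _ => mB.
  have : 2 * W * m <= 2 * W * B by apply: ler_wpM2l => //; rewrite mulr_ge0.
  rewrite /V; lra.
have K0 : 0 <= K.
  by rewrite -(mean_cst X 1 0); apply: mean_le => s _; exact: sqr_ge0.
(* [L] bounds twice the second moment of the potential. *)
pose L := 2 * W * B + 4 * beta ^+ 2.
have L0 : 0 <= L.
  by rewrite /L; have := sqr_ge0 beta; have := mulr_ge0 W0 B0; nra.
exists (2 * K + 2 * V + L) => n n0.
apply: (@le_trans _ _ (mean X n (fun s => 2 * M s ^+ 2
    + (2 * W * (bad_run s)%:R ^+ 2 + 4 * beta ^+ 2)))).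
  apply: mean_le => s _.
  have := potential_sq (bad_run s); rewrite -/W /M.
  set f := potential _; set e := excess _ _; set w := W * _.
  have := sqr_ge0 (e + 2 * f).
  have -> : 2 * W * (bad_run s)%:R ^+ 2 = 2 * w by rewrite /w; ring.
  nra.
rewrite !meanD !meanZ mean_cst.
have := mean_bad_run_sq n n0; rewrite -/B; set m := mean _ _ (fun s => _%:R ^+ 2).
move=> mB; have Wm : 2 * W * m <= 2 * W * B by apply: ler_wpM2l => //; rewrite mulr_ge0.
have := MV n n0; set mm := mean _ _ _ => mM.
have n1 : 1 <= n%:R :> R by rewrite ler1n.
have Kn : K <= K * n%:R by rewrite ler_peMr.
have Ln : L <= L * n%:R by rewrite ler_peMr.
rewrite /L in Ln *; lra.
Qed.

End SecondMoment.

(** * Almost sure convergence *)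

Lemma ae_cvg0_of_summable {d : measure_display} {T : measurableType d}
    {R : realType} (mu : {measure set T -> \bar R}) (f : nat -> T -> R) :
  (forall k, measurable_fun setT (f k)) -> (forall k w, 0 <= f k w) ->
  (\sum_(0 <= k <oo) \int[mu]_w (f k w)%:E < +oo)%E ->
  {ae mu, forall w, f ^~ w @ \oo --> (0 : R)}.
Proof.
move=> mf f0 fi.
have mF k : measurable_fun setT (fun w => (f k w)%:E).
  by apply/measurable_EFinP; exact: mf.
have F0 k w : setT w -> (0 <= (f k w)%:E)%E by rewrite lee_fin.
pose S w : \bar R := (\sum_(0 <= k <oo) (f k w)%:E)%E.
have S0 w : (0 <= S w)%E by apply: nneseries_ge0 => *; exact: F0.
(* By monotone convergence the series has finite integral, so it is finite almost everywhere and its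
   tails, which dominate its terms, tend to 0. *)
have Si : mu.-integrable setT S.
  apply/integrableP; split; first by apply: ge0_emeasurable_sum => // *; exact: F0.
  under eq_integral do rewrite gee0_abs //.
  by rewrite integral_nneseries.
apply: filterS (integrable_ae measurableT Si) => w /(_ I) Sw.
have Sw' : (S w < +oo)%E by rewrite ltey_eq Sw.
have tail := nneseries_tail_cvg Sw' (fun k _ => F0 k w I).
have fE : (fun k => (f k w)%:E) @ \oo --> (0 : \bar R)%E.
  apply: squeeze_cvge (cvg_cst _) tail; apply: nearW => k.
  rewrite F0 //=; apply: le_trans (nneseries_lim_ge k.+1 _).
    by rewrite big_nat1.
  by move=> *; exact: F0.
by have /fine_cvgP[_] := fE.
Qed.

Section AlmostSure.
Context {d : measure_display} {T : measurableType d} {R : realType}.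
Variables (P : probability T R) (X : nat -> {RV P >-> bool}) (p r : R).
Hypotheses (p01 : 0 < p < 1) (r01 : 0 < r < 1) (chX : ge_channel p r X).

Let c : R := p / (r * (p + r)).

Lemma excess_squares_ae : {ae P, forall w,
  (fun k : nat => (excess c (hist X (k.+1 ^ 2) w)
     / (k.+1 ^ 2)%:R) ^+ 2) @ \oo --> (0 : R)}.
Proof.
have [C HC] := mean_excess_sq P X p r p01 r01 chX.
pose g k s : R := (excess c s / (k.+1 ^ 2)%:R) ^+ 2.
have g0 k s : 0 <= g k s by exact: sqr_ge0.
have C0 : 0 <= C.
  have := HC 1%N isT; rewrite mulr1; apply: le_trans.
  by rewrite -(mean_cst X 1 0); apply: mean_le => s _; exact: sqr_ge0.
apply: (ae_cvg0_of_summable P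
  (fun k w => g k (hist X (k.+1 ^ 2) w))).
- by move=> k; exact: measurable_hist_fun.
- by move=> k w; exact: g0.
apply: (@le_lt_trans _ _ (2 * C)%:E); last exact: ltry.
have int0 k : (0 <= \int[P]_w (g k (hist X (k.+1 ^ 2) w))%:E)%E.
  by apply: integral_ge0 => w _; rewrite lee_fin.
apply: lime_le; first by apply: is_cvg_nneseries => *; exact: int0.
apply: nearW => n.
(* Each integral is at most C / x^2 with x = k + 1, and C / x^2 <= 2 C / x - 2 C / (x+1)
   telescopes. *)
suff : (\sum_(0 <= k < n) \int[P]_w (g k (hist X (k.+1 ^ 2) w))%:E
    <= (2 * C - 2 * C / n.+1%:R)%:E)%E.
  move=> /le_trans; apply; rewrite lee_fin gerBl divr_ge0 ?mulr_ge0 //.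
elim: n => [|n IHn]; first by rewrite big_geq // lee_fin divr1 subrr.
have -> : 2 * C - 2 * C / n.+2%:R
    = (2 * C - 2 * C / n.+1%:R) + (2 * C / n.+1%:R - 2 * C / n.+2%:R) by ring.
rewrite big_nat_recr //= EFinD; apply: leeD IHn _.
rewrite integral_hist // lee_fin.
have n0 : 0 < n.+1%:R :> R by rewrite ltr0n.
have -> : mean X (n.+1 ^ 2) (g n)
    = (n.+1%:R ^+ 4)^-1 * mean X (n.+1 ^ 2) (fun s => excess c s ^+ 2).
  rewrite -meanZ; congr mean; apply/funext => s.
  by rewrite /g natrX; field; lra.
apply: (@le_trans _ _ ((n.+1%:R ^+ 4)^-1 * (C * (n.+1 ^ 2)%:R))).
  by apply: ler_wpM2l; [rewrite invr_ge0 exprn_ge0 // ltW | apply: HC; rewrite expn_gt0].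
rewrite natrX -[n.+2%:R]natr1 -subr_ge0; set x := n.+1%:R in n0 *.
have x1 : 1 <= x by rewrite ler1n.
have -> : 2 * C / x - 2 * C / (x + 1) - (x ^+ 4)^-1 * (C * x ^+ 2)
    = C * (x - 1) / (x ^+ 2 * (x + 1)) by field; lra.
by rewrite divr_ge0 ?mulr_ge0 ?subr_ge0 ?exprn_ge0 //; lra.
Qed.

Lemma excess_ae : {ae P, forall w,
  (fun n : nat => excess c (hist X n w) / n%:R) @ \oo --> (0 : R)}.
Proof.
have /andP[p0 p1] := p01; have /andP[r0 r1] := r01.
apply: filterS excess_squares_ae => w sq.
pose x i := X i w.
pose a n : R := (\sum_(0 <= i < n) bad_run (past x i))%:R.
have aE : (fun n : nat => excess c (past x n) / n%:R)
    = (fun n : nat => (a n - n%:R * c) / n%:R).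
  by apply/funext => n; rewrite excess_past.
rewrite aE; apply: cvg_squares.
- by rewrite divr_ge0 ?mulr_ge0 //; lra.
- move=> m n mn; rewrite ler_nat [leqRHS](big_cat_nat (n := m)) //=; exact: leq_addr.
(* The squares start at 1, hence the shift; tolerance e^2 for the squared ratio gives tolerance e
   for the ratio. *)
rewrite -cvg_shiftS.
apply/cvgrPdist_le => e e0.
move/cvgrPdist_le : sq => /(_ _ (exprn_gt0 2 e0)).
apply: filterS => k; rewrite !sub0r !normrN /hist excess_past -/(a _).
by rewrite normrX ler_pXn2r ?nnegrE // ltW.
Qed.

End AlmostSure.

Theorem mainTheorem5 (R : realType) (d : measure_display)
    (T : measurableType d) (P : probability T R) (p r : R)
    (X : nat -> {RV P >-> bool}) (init : nat -> R) :
  0 < p < 1 -> 0 < r < 1 ->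
  ge_channel p r X ->
  time_average_as P
    (fun t w => plgfs_aoi init generate_at_will (fun s => X s w) t)
    (1 + p / (r * (p + r))).
Proof.
move=> p01 r01 chX; apply: filterS (excess_ae P X p r p01 r01 chX) => w.
exact: time_average_past.
Qed.
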